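(* For every integer $n\ge 1$, the fourth factorial moment of the area statistic on parking functions of length $n$ is $$\mathbb{E}\big[\mathrm{Area}(\mathrm{Area}-1)(\mathrm{Area}-2)(\mathrm{Area}-3)\big]=\frac{221}{1008}n^{6}+\frac{63737}{30240}n^{5}+\frac{101897}{15120}n^{4}+\frac{22217}{5040}n^{3}-\frac{1375}{189}n^{2}-\frac{187463}{30240}n$$ $$+\left(-\frac{35}{16}n^{4}-\frac{449}{27}n^{3}-\frac{130243}{2520}n^{2}-\frac{7409}{105}n-\frac{503803}{15120}\right)E_1(n),$$ and asymptotically it equals $\frac{221}{1008}n^{6}+O(n^{11/2})$ as $n\to\infty$.
   Context: A parking function of length $n$ is a vector $(p_1,\dots,p_n)$ of positive integers such that its weakly increasing rearrangement $p_{(1)}\le p_{(2)}\le\dots\le p_{(n)}$ satisfies $p_{(i)}\le i$ for all $1\le i\le n$. There are $(n+1)^{n-1}$ of them. The area statistic is $\mathrm{Area}(p)=\frac{n(n+1)}{2}-\sum_{i=1}^n p_i$. Expectations are taken with respect to the uniform distribution on the set of parking functions of length $n$; the $k$-th factorial moment is $\mathbb{E}[\mathrm{Area}(\mathrm{Area}-1)\cdots(\mathrm{Area}-k+1)]$. Here $E_1(n)$ denotes $$E_1(n)= -\frac{n}{2}+\frac{1}{2}\,\frac{(n+1)!}{(n+1)^{n}}\sum_{k=0}^{n-1}\frac{(n+1)^k}{k!},$$ which is the expectation of the area statistic on parking functions of length $n$. *)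

(* Defs.v *)
From mathcomp Require Import all_boot all_order all_algebra.
From mathcomp Require Import all_classical all_reals all_analysis.

Set Implicit Arguments.
Unset Strict Implicit.
Unset Printing Implicit Defensive.

Import Order.TTheory GRing.Theory Num.Theory.
Import numFieldNormedType.Exports.

Local Open Scope ring_scope.

(* [i] ranges over 0, ..., n-1, so the bound p_(i) <= i of the usual 1-based
   indexing becomes [<= i.+1]. *)
Definition is_parking_function (n : nat) (p : n.-tuple nat) : bool :=
  all (leq 1) p && [forall i : 'I_n, nth 0%N (sort leq p) i <= i.+1]%N.

(* The entries of a parking function of length n are at most n, so drawing them
   from 'I_n.+1 = {0, ..., n} loses nothing; see [parking_functions_complete]. *)
Definition parking_functions (n : nat) : {set n.-tuple 'I_n.+1} :=
  [set p | is_parking_function (map_tuple val p)].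

Lemma parking_functions_complete (n : nat) (p : n.-tuple nat) :
  is_parking_function p ->
  exists2 q, q \in parking_functions n & map_tuple val q = p.
Proof.
move=> pP.
have le_n x : x \in (p : seq nat) -> (x < n.+1)%N.
  rewrite -(mem_sort leq) => /(nthP 0%N)[i].
  rewrite size_sort size_tuple => lt_in <-.
  have /andP[_ /forallP/(_ (Ordinal lt_in))] := pP.
  by move=> /leq_ltn_trans; apply.
pose q : n.-tuple 'I_n.+1 := map_tuple inord p.
have qE : map_tuple val q = p.
  apply: val_inj; rewrite /= -map_comp -[RHS]map_id.
  by apply/eq_in_map => x /le_n xn /=; rewrite inordK.
by exists q; rewrite // inE qE.
Qed.

(* n * n.+1 is even, so the halving is exact. *)
Definition area (n : nat) (p : n.-tuple 'I_n.+1) : int :=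
  ((n * n.+1)./2)%:Z - \sum_(i < n) (tnth p i : nat)%:Z.

Definition uniform_expectation (R : fieldType) (T : finType) (A : {set T})
    (X : T -> R) : R :=
  (\sum_(x in A) X x) / #|A|%:R.

Definition area_factorial_moment (R : fieldType) (n k : nat) : R :=
  uniform_expectation (parking_functions n)
    (fun p => \prod_(j < k) ((area p)%:~R - j%:R)).

Definition E1 (R : fieldType) (n : nat) : R :=
  - (n%:R / 2) +
  1 / 2 * ((n.+1)`!%:R / n.+1%:R ^+ n) *
    \sum_(0 <= k < n) (n.+1%:R ^+ k / k`!%:R).

(* Main.v *)
(** Let [S p = \sum (p_i - 1)] and let [s_n(q)] be the sum of [q ^ S p] over the
    parking functions of length [n].  Toggling the position of a largest letter
    in or out of a set of positions is a sign-reversing involution, and gives,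
    with [[k] = 1 + q + ... + q^(k-1)],
      [\sum_k binomial(n, k) s_k(q) (- [k+1])^(n-k) = 0]   for [n > 0].
    Expanding at [q = 1 + t], the coefficient [a_i(n)] of [t^i] in [s_n], which is
    the sum of [binomial(S p, i)] over the parking functions, is determined by
    [a_0], ..., [a_(i-1)] through the transform
      [c |-> (n |-> \sum_k binomial(n, k) c_k (- (k+1))^(n-k))],
    which substitutes [x e^-x] in the exponential generating function of [c] and
    multiplies the result by [e^-x].  It is injective, and the transforms of all
    the sequences involved are polynomials in [u = 1 / (1 - x)]: that of [a_0]
    is [1], as is that of [(k+1)^(k-1)], that of [k! \sum_(j <= k) (k+1)^j / j!] is
    [u^2], and multiplying a sequence by [k+1] acts as
    [u^b |-> b u^(b+2) - (b-1) u^(b+1)].  So the formula for the fourth moment is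
    an identity between integer polynomials in [u], settled by computation.

    For the asymptotics, [E1 = (N T - 2 N + 1) / 2] with [N = n+1] and
    [T = \sum_j r_j], [r_j = \prod_(i <= j) (1 - i / N)]; since [r] decreases,
    [T ^ 2 <= 2 \sum_j (j+1) r_j], and this sum telescopes to [N]. *)
From Stdlib Require Import BinInt.
Require Import Defs.
From mathcomp Require Import all_boot all_order all_algebra.
From mathcomp Require Import all_classical all_reals all_analysis.
From mathcomp Require Import ring lra zify ssrZ.

Set Implicit Arguments.
Unset Strict Implicit.
Unset Printing Implicit Defensive.

Import Order.TTheory GRing.Theory Num.Theory.
Import numFieldNormedType.Exports.

Local Open Scope classical_set_scope.
Local Open Scope ring_scope.
(* [%Z] denotes mathcomp's [int_scope]. *)
Delimit Scope Z_scope with BZ.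

(** * Words and parking functions *)

(** A recursion on the length, so that words can be split, concatenated and masked without casts
    between tuple types. *)
Fixpoint wsum (S : nmodType) (T : Type) (s : seq T) (n : nat)
    (F : seq T -> S) : S :=
  if n is n'.+1 then \sum_(a <- s) wsum s n' (fun w => F (a :: w)) else F [::].

Section Words.
Variable S : nmodType.

Lemma eq_wsum (T : Type) (s : seq T) n (F G : seq T -> S) :
  (forall w, size w = n -> F w = G w) -> wsum s n F = wsum s n G.
Proof.
elim: n F G => [|n IH] F G eqFG /=; first exact: eqFG.
by apply: eq_bigr => a _; apply: IH => w sw; apply: eqFG; rewrite /= sw.
Qed.

Lemma wsum0 (T : Type) (s : seq T) n : wsum s n (fun=> 0 : S) = 0.
Proof. by elim: n => //= n IH; rewrite big1. Qed.

Lemma wsum_sum (T I : Type) (s : seq T) n (r : seq I) (F : I -> seq T -> S) :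
  wsum s n (fun w => \sum_(i <- r) F i w) = \sum_(i <- r) wsum s n (F i).
Proof.
elim: n F => //= n IH F; rewrite exchange_big /=.
by apply: eq_bigr => a _; rewrite IH.
Qed.

Lemma exchange_wsum (T U : Type) (s : seq T) (t : seq U) n m
    (F : seq T -> seq U -> S) :
  wsum s n (fun w => wsum t m (F w)) = wsum t m (fun v => wsum s n (F^~ v)).
Proof.
elim: n F => //= n IH F; rewrite wsum_sum.
by apply: eq_bigr => a _; rewrite IH.
Qed.

Lemma wsum_cat (T : Type) (s : seq T) n m (F : seq T -> S) :
  wsum s (n + m) F = wsum s n (fun w => wsum s m (fun v => F (w ++ v))).
Proof. by elim: n F => //= n IH F; apply: eq_bigr => a _; rewrite IH. Qed.

Lemma wsum_filter (T : Type) (P : pred T) (s : seq T) n (F : seq T -> S) :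
  (forall w, size w = n -> ~~ all P w -> F w = 0) ->
  wsum (seq.filter P s) n F = wsum s n F.
Proof.
elim: n F => //= n IH F F0; rewrite big_filter [RHS](bigID P) /=.
rewrite [X in _ = _ + X]big1 ?addr0 => [|a Pa].
  apply: eq_bigr => a Pa; rewrite IH // => w sw Pw.
  by apply: F0; rewrite /= ?sw ?Pa.
rewrite -[RHS](wsum0 s n); apply: eq_wsum => w sw.
by apply: F0; rewrite /= ?sw ?(negPf Pa).
Qed.

Lemma sum_tuple_wsum (T : finType) n (F : seq T -> S) :
  \sum_(p : n.-tuple T) F p = wsum (enum T) n F.
Proof.
elim: n F => [|n IH] F /=.
  rewrite (big_pred1 [tuple]) // => p; apply/esym/eqP; exact: tuple0.
rewrite big_enum /=.
rewrite (reindex (fun x : T * n.-tuple T => [tuple of x.1 :: x.2])) /=; last first.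
  exists (fun p => (thead p, [tuple of behead p])) => [[a p] _|p _] /=.
    by rewrite theadE; congr (_, _); apply: val_inj.
  by rewrite [RHS]tuple_eta; apply: val_inj.
rewrite -(pair_big xpredT xpredT (fun a (p : n.-tuple T) => F (a :: p))) /=.
by apply: eq_bigr => a _; rewrite -(IH (fun w => F (a :: w))).
Qed.

Lemma wsum_map (T U : Type) (f : T -> U) s n (F : seq U -> S) :
  wsum (map f s) n F = wsum s n (fun w => F (map f w)).
Proof.
by elim: n F => //= n IH F; rewrite big_map; apply: eq_bigr => a _; rewrite IH.
Qed.

Lemma wsum_count n (F : nat -> S) :
  wsum [:: true; false] n (fun m => F (count id m)) =
  \sum_(k < n.+1) F k *+ 'C(n, k).
Proof.
elim: n F => [|n IH] F; first by rewrite /= big_ord1 bin0 mulr1n.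
rewrite /= !big_cons big_nil addr0 (IH (fun k => F k.+1)) (IH F).
rewrite [RHS]big_ord_recl bin0 mulr1n.
under [in RHS]eq_bigr do rewrite /bump /= binS mulrnDr.
rewrite big_split /= addrA addrC; congr (_ + _).
rewrite [in LHS]big_ord_recl bin0 mulr1n [in RHS]big_ord_recr /= bin_small //.
by rewrite mulr0n addr0; congr (_ + _); apply: eq_bigr.
Qed.

End Words.

Section RingWords.
Variable S : comPzRingType.

Lemma wsum_mulrl (T : Type) (s : seq T) n (c : S) F :
  wsum s n (fun w => c * F w) = c * wsum s n F.
Proof.
by elim: n F => //= n IH F; rewrite mulr_sumr; apply: eq_bigr => a _; rewrite IH.
Qed.

Lemma wsum_prod (T : Type) (s : seq T) n (h : T -> S) :
  wsum s n (fun w => \prod_(a <- w) h a) = (\sum_(a <- s) h a) ^+ n.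
Proof.
elim: n => [|n IH] /=; first by rewrite big_nil.
rewrite exprS -IH mulr_suml; apply: eq_bigr => a _; rewrite -wsum_mulrl.
by apply: eq_wsum => w _; rewrite big_cons.
Qed.

(** Once the mask is fixed, the selected letters and the remaining ones vary independently. *)
Lemma wsum_mask (T : Type) (s : seq T) (m : bitseq) (G H : seq T -> S) :
  wsum s (size m) (fun w => G (mask m w) * H (mask (map negb m) w)) =
  wsum s (count id m) G * wsum s (size m - count id m) H.
Proof.
elim: m G H => [|b m IH] G H //=.
have le_m := count_size id m.
case: b => /=.
  rewrite add1n subSS /= mulr_suml; apply: eq_bigr => a _.
  exact: (IH (fun w => G (a :: w))).
rewrite add0n subSn //= mulr_sumr; apply: eq_bigr => a _.
exact: (IH G (fun w => H (a :: w))).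
Qed.

Lemma big_mask_compl (T : Type) (m : bitseq) (w : seq T) (h : T -> S) :
  size w = size m ->
  \prod_(a <- w) h a =
  \prod_(a <- mask m w) h a * \prod_(a <- mask (map negb m) w) h a.
Proof.
elim: m w => [|b m IH] [|a w] //= => [_|[/IH IHw]]; first by rewrite !big_nil mulr1.
by case: b; rewrite /= !big_cons IHw; [rewrite mulrA | rewrite mulrCA].
Qed.

End RingWords.

(** * Parking words and their largest letter *)

Definition parking_word (v : seq nat) : bool :=
  all (leq 1) v &&
  all (fun i => nth 0%N (sort leq v) i <= i.+1)%N (iota 0 (size v)).

Lemma sort_leq_max (v1 v2 : seq nat) (M : nat) :
  all (leq^~ M) (v1 ++ v2) ->
  sort leq (v1 ++ M :: v2) = rcons (sort leq (v1 ++ v2)) M.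
Proof.
move=> leM; apply: (sorted_eq leq_trans anti_leq).
- exact: (sort_sorted leq_total).
- rewrite (sorted_pairwise leq_trans) pairwise_rcons -(sorted_pairwise leq_trans).
  rewrite (sort_sorted leq_total) andbT.
  by apply/allP => x; rewrite mem_sort => /(allP leM).
- rewrite perm_sort -cat1s perm_catCA perm_sym perm_rcons perm_cons.
  by rewrite perm_sort.
Qed.

(** A largest letter comes last after sorting, so it enters only the last of the parking
    inequalities. *)
Lemma parking_word_max (v1 v2 : seq nat) (M : nat) :
  all (leq^~ M) (v1 ++ v2) ->
  parking_word (v1 ++ M :: v2) =
  parking_word (v1 ++ v2) && (1 <= M <= (size (v1 ++ v2)).+1)%N.
Proof.
move=> leM; rewrite /parking_word sort_leq_max //.
have -> : size (v1 ++ M :: v2) = (size (v1 ++ v2)).+1.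
  by rewrite !size_cat addnS.
have -> : all (leq 1) (v1 ++ M :: v2) = all (leq 1) (v1 ++ v2) && (0 < M)%N.
  by rewrite !all_cat /= andbCA andbC.
have -> k : iota 0 k.+1 = iota 0 k ++ [:: k] by rewrite -addn1 iotaD.
set s := v1 ++ v2; rewrite [in LHS]all_cat /= andbT.
rewrite nth_rcons size_sort ltnn eqxx -!andbA; congr andb.
rewrite andbCA; congr andb.
apply: eq_in_all => i; rewrite mem_iota add0n /= => lt_i.
by rewrite nth_rcons size_sort lt_i.
Qed.

Lemma parking_word_le (v : seq nat) :
  parking_word v -> all (leq^~ (size v)) v.
Proof.
case/andP=> _ /allP Pv; apply/allP => x.
rewrite -(mem_sort leq) => /(nthP 0%N)[i]; rewrite size_sort => lt_i <- /=.
by apply: (leq_trans _ lt_i); have /= := Pv i; rewrite mem_iota add0n lt_i; apply.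
Qed.

Lemma split_max (w : seq nat) : w != [::] ->
  exists w1 M w2, w = w1 ++ M :: w2 /\ all (leq^~ M) (w1 ++ w2).
Proof.
elim: w => // a [|b w] IH _; first by exists [::], a, [::].
have [//|w1 [M [w2 [-> leM]]]] := IH.
have [le_aM|lt_Ma] := leqP a M; first by exists (a :: w1), M, w2; rewrite /= le_aM.
exists [::], a, (w1 ++ M :: w2); split=> //=.
have: all (leq^~ M) (w1 ++ M :: w2) by move: leM; rewrite !all_cat /= leqnn.
by apply: sub_all => x /leq_trans; apply; apply: ltnW.
Qed.

(** * The sign-reversing involution and the q-recurrence *)

Section Toggle.
Variable S : comNzRingType.

Lemma prod_indicator (T : Type) (P : pred T) (v : seq T) :
  \prod_(a <- v) (P a)%:R = (all P v)%:R :> S.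
Proof.
elim: v => [|a v IH]; first by rewrite big_nil.
by rewrite big_cons IH -natrM mulnb.
Qed.

Definition letters_le (k : nat) (v : seq nat) : bool :=
  all (fun a => 1 <= a <= k.+1)%N v.

(* Moving the position of a largest letter in or out of the mask preserves the
   condition and changes the sign. *)
Lemma sum_signed_masks (w : seq nat) : w != [::] ->
  wsum [:: true; false] (size w) (fun m =>
    (-1) ^+ count negb m *
    (parking_word (mask m w) && letters_le (count id m) (mask (map negb m) w))%:R)
  = 0 :> S.
Proof.
move=> /split_max[w1 [M [w2 [-> leM]]]].
rewrite size_cat wsum_cat -[RHS](wsum0 _ [:: true; false] (size w1)).
apply: eq_wsum => m1 sm1 /=.
rewrite !big_cons big_nil addr0; apply/eqP; rewrite addr_eq0 -[X in _ == X]mulN1r -wsum_mulrl.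
apply/eqP/eq_wsum => m2 sm2.
rewrite !map_cat !count_cat !mask_cat ?size_map //= add0n add1n !addnS exprS.
rewrite !mulN1r mulNr opprK; congr (_ * _%:R); congr nat_of_bool.
set v1 := mask m1 w1; set v2 := mask m2 w2.
have leMv : all (leq^~ M) (v1 ++ v2).
  move: leM; rewrite !all_cat => /andP[/allP l1 /allP l2].
  by apply/andP; split; apply/allP => x /mem_mask; [apply: l1 | apply: l2].
have leMr : all (leq^~ M) (mask (map negb m1) w1 ++ mask (map negb m2) w2).
  move: leM; rewrite !all_cat => /andP[/allP l1 /allP l2].
  by apply/andP; split; apply/allP => x /mem_mask; [apply: l1 | apply: l2].
rewrite parking_word_max // size_cat !size_mask //.
rewrite -andbA; congr andb; rewrite /letters_le all_cat /=.
set r1 := mask _ w1 in leMr *; set r2 := mask _ w2 in leMr *.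
set k := (count id m1 + count id m2)%N; rewrite ?add0n -/k.
rewrite [in RHS]all_cat /= [in RHS]andbCA -!all_cat.
(* Both sides require [1 <= M <= k+1]. The remaining letters are at most [M], so their upper bounds,
   [k+2] on one side and [k+1] on the other, then hold automatically. *)
case: (boolP (1 <= M <= k.+1)%N) => //= /andP[_ leMk].
apply: eq_in_all => x /(allP leMr) le_xM; rewrite (leq_trans le_xM leMk).
by rewrite (leq_trans (leq_trans le_xM leMk)).
Qed.

Definition qint (q : S) (k : nat) : S := \sum_(i < k) q ^+ i.

Definition displacement (v : seq nat) : nat := (\sum_(a <- v) a.-1)%N.

Definition parking_gf (q : S) (n : nat) : S :=
  wsum (iota 0 n.+1) n (fun v => (parking_word v)%:R * q ^+ displacement v).

(** Letters of a parking word never exceed its length, so the subwords on all masks can share one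
    alphabet. *)
Lemma parking_gf_alphabet (q : S) (N n : nat) : (n < N)%N ->
  wsum (iota 0 N) n (fun v => (parking_word v)%:R * q ^+ displacement v) =
  parking_gf q n.
Proof.
move=> lt_nN; rewrite /parking_gf -[iota 0 n.+1](filter_iota_leq 0 lt_nN).
rewrite wsum_filter // => w <- /negP nle.
by have [/parking_word_le/nle|_] := boolP (parking_word w); rewrite ?mul0r.
Qed.

Lemma displacement_mask (q : S) (m : bitseq) (w : seq nat) : size w = size m ->
  q ^+ displacement w =
  q ^+ displacement (mask m w) * \prod_(a <- mask (map negb m) w) q ^+ a.-1.
Proof.
by move=> sw; rewrite /displacement !expr_sum (big_mask_compl _ sw).
Qed.

Lemma qint_sum (q : S) (k N : nat) : (k.+1 < N)%N ->
  \sum_(a <- iota 0 N) (1 <= a <= k.+1)%:R * q ^+ a.-1 = qint q k.+1.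
Proof.
case: N => // N lt_kN; rewrite /= big_cons mul0r add0r.
have -> : iota 1 N = index_iota 1 N.+1 by rewrite /index_iota subn1.
rewrite big_add1 big_mkord /qint.
rewrite (big_ord_widen _ (fun i => q ^+ i) (ltnSE lt_kN)) [RHS]big_mkcond /=.
by apply: eq_bigr => a _; rewrite ltnS; case: leqP; rewrite ?mul1r ?mul0r.
Qed.

(** [[k+1]^(n-k)] counts the words of length [n-k] on the letters [1..k+1], so the left side is a
    signed sum over pairs of a mask and a word. Summing over the masks first gives zero by
    [sum_signed_masks]. *)
Lemma parking_gf_rec (q : S) (n : nat) : (0 < n)%N ->
  \sum_(k < n.+1) parking_gf q k * (- qint q k.+1) ^+ (n - k) *+ 'C(n, k) = 0.
Proof.
move=> n_gt0.
pose f k := parking_gf q k * (- qint q k.+1) ^+ (n - k).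
rewrite -(wsum_count n f).
pose G v := (parking_word v)%:R * q ^+ displacement v : S.
pose H k v := \prod_(a <- v) ((1 <= a <= k.+1)%:R * q ^+ a.-1) : S.
transitivity (wsum [:: true; false] n (fun m => wsum (iota 0 n.+1) n (fun w =>
    (-1) ^+ count negb m * (G (mask m w) * H (count id m) (mask (map negb m) w))))).
  apply: eq_wsum => m sm; rewrite wsum_mulrl.
  have := wsum_mask (iota 0 n.+1) m G (H (count id m)); rewrite sm => ->.
  have le_m : (count id m <= n)%N by rewrite -sm count_size.
  have cN : (n - count id m = count negb m)%N.
    by rewrite -sm -(count_predC id m) addKn.
  rewrite /f parking_gf_alphabet // wsum_prod [(- qint _ _) ^+ _]exprNn.
  rewrite mulrCA -cN; congr (_ * (_ * _)).
  (* The alphabet [0..n] contains [k+1] only for [k < n]; for [k = n] the exponent is zero. *)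
  have [lt_m|] := ltnP (count id m) n; first by rewrite qint_sum.
  by rewrite -subn_eq0 => /eqP->.
rewrite -exchange_wsum -[RHS](wsum0 S (iota 0 n.+1) n); apply: eq_wsum => w sw.
rewrite -[RHS](mulr0 (q ^+ displacement w)).
have w0 : w != [::] by rewrite -size_eq0 sw -lt0n.
rewrite -(sum_signed_masks w0) sw -wsum_mulrl; apply: eq_wsum => m sm.
rewrite (@displacement_mask q m) ?sw ?sm // /G /H /letters_le.
rewrite big_split /= prod_indicator -mulnb natrM.
by move: (\prod_(i <- _) _) => z; ring.
Qed.
End Toggle.

(** * The Abel transform *)

(* On exponential generating functions: [C |-> e^-x C(x e^-x)]. *)
Definition abel (A : pzRingType) (c : nat -> A) (n : nat) : A :=
  \sum_(k < n.+1) c k * (- k.+1%:R) ^+ (n - k) *+ 'C(n, k).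

Section Abel.
Variable A : comNzRingType.
Implicit Types c d : nat -> A.

Lemma eq_abel c d : c =1 d -> abel c =1 abel d.
Proof. by move=> cd n; apply: eq_bigr => k _; rewrite cd. Qed.

(** The transform is triangular with ones on the diagonal. *)
Lemma abel_inj c d : abel c =1 abel d -> c =1 d.
Proof.
move=> cd n; elim/ltn_ind: n => n IH.
have := cd n; rewrite /abel !big_ord_recr /= subnn !binn !mulr1.
by rewrite (eq_bigr (fun k : 'I_n => d k * (- k.+1%:R) ^+ (n - k) *+ 'C(n, k)))
  => [/addrI|k _]; last by rewrite IH.
Qed.

Lemma abelD c d n : abel (fun k => c k + d k) n = abel c n + abel d n.
Proof.
rewrite -big_split; apply: eq_bigr => k _; by rewrite mulrDl mulrnDl.
Qed.

Lemma abelZ a c n : abel (fun k => a * c k) n = a * abel c n.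
Proof.
by rewrite mulr_sumr; apply: eq_bigr => k _; rewrite -mulrA mulrnAr.
Qed.

Lemma abel0 n : abel (fun=> 0 : A) n = 0.
Proof. by apply: big1 => k _; rewrite mul0r mul0rn. Qed.

Lemma abel_n0 c : abel c 0 = c 0%N.
Proof. by rewrite /abel big_ord1 mulr1 mulr1n. Qed.

(* If [F] and [G] are the transforms of [c_k] and [(k+1) c_k], then
   [(1 - x) G = (x F)']. *)
Lemma abel_succ c n :
  abel (fun k => k.+1%:R * c k) n.+1 =
  n.+2%:R * abel c n.+1 + n.+1%:R * abel (fun k => k.+1%:R * c k) n.
Proof.
rewrite /abel big_ord_recr [X in _ = _ * X + _]big_ord_recr /= subnn binn.
rewrite !mulr1 !mulr1n mulrDr addrAC; congr (_ + _).
rewrite !mulr_sumr -big_split; apply: eq_bigr => -[k lt_kn] _ /=.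
rewrite subSn // exprS.
have E : (n.+1 * 'C(n, k) = (n.+1 - k) * 'C(n.+1, k))%N by rewrite -mul_bin_down.
have {}E : n.+1%:R * 'C(n, k)%:R = (n.+2%:R - k.+1%:R) * 'C(n.+1, k)%:R :> A.
  by rewrite -natrB 1?ltnW // subSS -!natrM E.
have mN (x y : A) m : (x * y) *+ m = x * y * m%:R by rewrite mulr_natr.
rewrite !mN.
move: {E}'C(n.+1, k)%:R 'C(n, k)%:R n.+1%:R n.+2%:R k.+1%:R E (c k).
move=> p r N1 N2 K E ck.
have -> X : N1 * (K * ck * X * r) = K * ck * X * (N1 * r) by ring.
by rewrite E; ring.
Qed.

Lemma mul_bin_trinomial n k j :
  ('C(n, k) * 'C(n - k, j) = 'C(n, j) * 'C(n - j, k))%N.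
Proof.
have [le_n|lt_n] := leqP (k + j) n; last first.
  have [lt_nk|le_kn] := ltnP n k; first by rewrite bin_small // [X in _ = (_ * X)%N]bin_small ?muln0 //; lia.
  rewrite [X in (_ * X)%N = _]bin_small; last lia.
  have [lt_nj|le_jn] := ltnP n j; first by rewrite [X in _ = (X * _)%N]bin_small ?muln0.
  by rewrite [X in _ = (_ * X)%N]bin_small ?muln0 //; lia.
have le_k : (k <= n)%N by lia.
have le_j : (j <= n)%N by lia.
have e : (n - k - j = n - j - k)%N by lia.
have := bin_fact le_k; have := bin_fact le_j.
have := @bin_fact (n - k) j; have := @bin_fact (n - j) k.
rewrite e; move=> /(_ ltac:(lia)) <- /(_ ltac:(lia)) <- E1 E2.
apply/eqP; rewrite -(@eqn_pmul2r (k`! * (j`! * (n - j - k)`!))) ?muln_gt0 ?fact_gt0 //.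
by apply/eqP; move: E1 E2; set a := 'C(n, k); set b := 'C(n, j); nia.
Qed.

(** Binomial expansion of the power, followed by a regrouping of the trinomial coefficients. Each
    power of [x] then carries a transform of its own, shifted by [j]. *)
Lemma abel_expand (s B : nat -> A) (x : A) n :
  \sum_(k < n.+1) s k * (- (k.+1%:R + x * B k)) ^+ (n - k) *+ 'C(n, k) =
  \sum_(j < n.+1) (- x) ^+ j * abel (fun k => s k * B k ^+ j) (n - j) *+ 'C(n, j).
Proof.
have widen (G : nat -> A) m : (m <= n)%N -> (forall j, (m < j)%N -> G j = 0) ->
    \sum_(j < m.+1) G j = \sum_(j < n.+1) G j.
  move=> le_mn G0; rewrite (big_ord_widen _ G (_ : (m < n.+1)%N)) // big_mkcond /=.
  by apply: eq_bigr => j _; case: ltnP => // /G0->.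
pose t k j := s k * (- k.+1%:R) ^+ (n - k - j) * (- x * B k) ^+ j
                *+ ('C(n, k) * 'C(n - k, j)).
transitivity (\sum_(k < n.+1) \sum_(j < n.+1) t k j).
  apply: eq_bigr => k _; rewrite opprD -mulNr exprDn mulr_sumr -sumrMnl.
  rewrite -(widen (t k) (n - k)%N) ?leq_subr //; last first.
    by move=> j lt_j; rewrite /t [X in (_ * X)%N]bin_small ?muln0.
  by apply: eq_bigr => j _; rewrite /t mulrnAr mulrA mulnC mulrnA.
rewrite exchange_big; apply: eq_bigr => j _ /=.
rewrite mulr_sumr -sumrMnl -(widen (t^~ j) (n - j)%N) ?leq_subr //; last first.
  by move=> k lt_k; rewrite /t mul_bin_trinomial [X in (_ * X)%N]bin_small ?muln0.
apply: eq_bigr => k _; rewrite /t mul_bin_trinomial mulrnAr -mulrnA mulnC.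
congr (_ *+ _); rewrite exprMn_comm; last exact: mulrC.
by rewrite subnAC; ring.
Qed.

End Abel.

(** * Expansion of the recurrence at q = 1 + t *)

Section PolyAbel.
Variable A : comNzRingType.

Lemma coef_1X n i : ((1 + 'X) ^+ n : {poly A})`_i = 'C(n, i)%:R.
Proof.
rewrite exprDn coef_sum; under eq_bigr do rewrite expr1n mul1r coefMn coefXn.
have [le_in|lt_ni] := ltnP i n.+1.
  rewrite (bigD1 (Ordinal le_in)) //= eqxx big1 ?addr0 // => j /negPf ne_j.
  by rewrite eq_sym -[j == i :> nat]/(j == Ordinal le_in) ne_j mul0rn.
rewrite bin_small // big1 // => j _.
by rewrite gtn_eqF ?mul0rn // (leq_trans (ltn_ord j) lt_ni).
Qed.

(** This is [([k+1] - (k+1)) / t] at [q = 1 + t]; see [sum_1X]. *)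
Definition qbrack_tail k : {poly A} := \poly_(i < k) 'C(k.+1, i.+2)%:R.

Lemma coef_qbrack_tail k i : (qbrack_tail k)`_i = 'C(k.+1, i.+2)%:R.
Proof. by rewrite coef_poly; case: ltnP => // le_ki; rewrite bin_small. Qed.

Lemma sum_1X k : \sum_(i < k.+1) (1 + 'X) ^+ i = k.+1%:R + 'X * qbrack_tail k.
Proof.
have E : 'X * \sum_(i < k.+1) (1 + 'X) ^+ i = (1 + 'X) ^+ k.+1 - 1 :> {poly A}.
  by rewrite subrX1 addrAC subrr add0r.
apply/polyP => i; have := congr1 (fun p : {poly A} => p`_i.+1) E.
rewrite coefXM coefB coef_1X coef1 subr0 /= => ->.
by rewrite coefD coefXM -polyC_natr coefC coef_qbrack_tail; case: i => [|i];
  rewrite /= ?bin1 ?addr0 ?add0r.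
Qed.

Lemma coef_abel (c : nat -> {poly A}) n i :
  (abel c n)`_i = abel (fun k => (c k)`_i) n.
Proof.
rewrite coef_sum; apply: eq_bigr => k _.
by rewrite coefMn -polyC_natr -polyCN -polyC_exp coefMC.
Qed.

(** The factor ['X ^+ j] discards [j > i], and the binomial discards [j > n], so the range need not
    depend on [n]. *)
Lemma coef_abel_expand (s : nat -> {poly A}) (B : nat -> {poly A}) n i :
  (\sum_(j < n.+1)
     (- 'X) ^+ j * abel (fun k => s k * B k ^+ j) (n - j) *+ 'C(n, j))`_i =
  \sum_(j < i.+1)
    (-1) ^+ j * abel (fun k => (s k * B k ^+ j)`_(i - j)) (n - j) *+ 'C(n, j).
Proof.
pose t j := (-1) ^+ j * abel (fun k => (s k * B k ^+ j)`_(i - j)) (n - j) *+ 'C(n, j).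
rewrite coef_sum; transitivity (\sum_(j < n.+1 | (j < i.+1)%N) t j).
  rewrite [RHS]big_mkcond; apply: eq_bigr => j _.
  have sgnE : (-1) ^+ j = ((-1) ^+ j)%:P :> {poly A} by rewrite polyC_exp polyCN.
  rewrite coefMn exprNn sgnE -mulrA coefCM coefXnM.
  by rewrite coef_abel ltnS /t; case: (leqP j i); rewrite ?mulr0 ?mul0rn.
have t0 j : (n < j)%N -> t j = 0 by move=> lt_nj; rewrite /t bin_small.
have [le_in|lt_ni] := leqP i n; first by rewrite -(big_ord_widen _ t).
rewrite -[RHS]/(\sum_(j < i.+1) t j).
rewrite [RHS](bigID (fun j : 'I_i.+1 => j < n.+1)%N) /=.
rewrite [X in _ = _ + X]big1 ?addr0 => [|j]; last by rewrite -leqNgt => /t0.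
rewrite -(big_ord_widen _ t (_ : n.+1 <= i.+1)%N) 1?ltnW //.
by apply: eq_bigl => j; rewrite (leq_trans (ltn_ord j)) // ltnW.
Qed.

End PolyAbel.

(** * Transforms that are polynomials in 1 / (1 - x) *)

Section RisingBasis.
Variable R : numFieldType.

(** Coefficients are binary integers, so that [vm_compute] can handle them. *)
Definition ofZ (z : Z) : R := (int_of_Z z)%:~R.

Lemma ofZD y z : ofZ (Z.add y z) = ofZ y + ofZ z.
Proof. by rewrite /ofZ -intrD -rmorphD. Qed.

Lemma ofZM y z : ofZ (Z.mul y z) = ofZ y * ofZ z.
Proof. by rewrite /ofZ -intrM -rmorphM. Qed.

Lemma ofZN z : ofZ (Z.opp z) = - ofZ z.
Proof. by rewrite /ofZ -mulrNz -rmorphN. Qed.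

Lemma ofZB y z : ofZ (Z.sub y z) = ofZ y - ofZ z.
Proof. by rewrite ofZD ofZN. Qed.

Lemma ofZ_nat n : ofZ (Z.of_nat n) = n%:R.
Proof. by rewrite /ofZ -[Z.of_nat n]/(Z_of_int (Posz n)) Z_of_intK. Qed.

Fixpoint pos_val (p : positive) : R :=
  match p with
  | xH => 1
  | xO p => 2 * pos_val p
  | xI p => 2 * pos_val p + 1
  end.

Lemma ofZ_pos p : ofZ (Zpos p) = pos_val p.
Proof.
elim: p => [p IH|p IH|//].
  rewrite (_ : Zpos _ = Z.add (Z.mul
    2%BZ (Zpos p)) 1%BZ) //.
  by rewrite ofZD ofZM IH.
rewrite (_ : Zpos _ = Z.mul
  2%BZ (Zpos p)) //.
by rewrite ofZM IH.
Qed.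

Lemma ofZ_neg p : ofZ (Zneg p) = - pos_val p.
Proof. by rewrite -ofZ_pos -ofZN. Qed.

(* [n!] times the coefficient of [x^n] in [(1 - x)^-b]. *)
Definition rising (b n : nat) : R := (\prod_(i < n) (b + i))%:R.

Lemma rising_n0 b : rising b 0 = 1. Proof. by rewrite /rising big_ord0. Qed.

(** Coefficientwise, [b u^b + x (u^b)' = b u^(b+1)]. *)
Lemma risingSn b n : (b%:R + n%:R) * rising b n = b%:R * rising b.+1 n.
Proof.
rewrite /rising -natrD -!natrM; congr (_%:R).
rewrite mulnC -(big_ord_recr _ (fun i => b + i)%N) big_ord_recl addn0.
by congr (_ * _)%N; apply: eq_bigr => i _; rewrite addnS.
Qed.

(** Coefficientwise, [u^(b+1) = u^b + x u^(b+1)]. *)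
Lemma risingS b n :
  rising b.+1 n.+1 = rising b n.+1 + n.+1%:R * rising b.+1 n.
Proof.
have -> : rising b n.+1 = b%:R * rising b.+1 n.
  rewrite /rising -natrM big_ord_recl addn0.
  by congr (_%:R); congr (_ * _)%N; apply: eq_bigr => i _; rewrite addnS.
rewrite -mulrDl {1}/rising big_ord_recr /= natrM mulrC; congr (_ * _).
by rewrite -natrD addSnnS.
Qed.

(* The list [l] stands for the polynomial [\sum_i l_i u^(b + i)] in
   [u = (1 - x)^-1]. *)
Fixpoint rising_comb (b : nat) (l : seq Z) (n : nat) : R :=
  if l is z :: l' then ofZ z * rising b n + rising_comb b.+1 l' n else 0.

Fixpoint add_coefs (l m : seq Z) : seq Z :=
  match l, m with
  | x :: l', y :: m' => Z.add x y :: add_coefs l' m'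
  | [::], _ => m
  | _, [::] => l
  end.

Definition scale_coefs (z : Z) := map (Z.mul z).

Lemma rising_comb_add b l m n :
  rising_comb b (add_coefs l m) n = rising_comb b l n + rising_comb b m n.
Proof.
elim: l m b => [|x l IH] [|y m] b; rewrite /= ?add0r ?addr0 //.
by rewrite IH ofZD; ring.
Qed.

Arguments add_coefs : simpl never.
Arguments Z.mul : simpl never.
Arguments Z.sub : simpl never.
Arguments Z.of_nat : simpl never.

Lemma rising_comb_scale b z l n :
  rising_comb b (scale_coefs z l) n = ofZ z * rising_comb b l n.
Proof.
by elim: l b => [|x l IH] b; rewrite /= ?mulr0 // IH ofZM mulrDr mulrA.
Qed.

(* [u^b |-> b u^(b+2) - (b-1) u^(b+1)], the effect of [abel_succ]. *)
Fixpoint times_succ (b : nat) (l : seq Z) : seq Z :=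
  if l is z :: l' then
    0%BZ ::
      add_coefs [:: Z.mul (Z.sub 1%BZ (Z.of_nat b)) z; Z.mul (Z.of_nat b) z]
        (times_succ b.+1 l')
  else [::].

Lemma rising_comb_succ0 b l : rising_comb b (times_succ b l) 0 = rising_comb b l 0.
Proof.
elim: l b => //= z l IH b; rewrite rising_comb_add IH /= !rising_n0.
rewrite !ofZM ofZB !ofZ_nat -[ofZ 0%BZ]/0 -[ofZ (Zpos _)]/1.
by ring.
Qed.

(** The same recurrence as in [abel_succ]; with the initial value in [rising_comb_succ0] it yields
    [represents_succ]. *)
Lemma rising_comb_succ b l n :
  rising_comb b (times_succ b l) n.+1 =
  n.+2%:R * rising_comb b l n.+1 + n.+1%:R * rising_comb b (times_succ b l) n.
Proof.
elim: l b => [|z l IH] b; first by rewrite /= !mulr0 addr0.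
rewrite /= !rising_comb_add IH /= !ofZM ofZB !ofZ_nat.
rewrite -[ofZ 0%BZ]/0 -[ofZ (Zpos _)]/1.
have E : n.+2%:R * rising b n.+1 =
         b%:R * rising b.+1 n.+1 + (1 - b%:R) * rising b n.+1.
  by rewrite -risingSn -[n.+2]addn1 natrD; ring.
rewrite mulrDr [n.+2%:R * (_ * _)]mulrCA E !(risingS b.+1) !(risingS b).
by ring.
Qed.

Definition represents (c : nat -> R) (l : seq Z) : Prop :=
  forall n, abel c n = rising_comb 0 l n.

Lemma represents_inj c d l : represents c l -> represents d l -> c =1 d.
Proof. by move=> cl dl; apply: abel_inj => n; rewrite cl dl. Qed.

(** Reduces an identity between sequences to the vanishing of a computed list. *)
Lemma represents_zero c l : represents c l -> all (pred1 0%BZ) l -> c =1 fun=> 0.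
Proof.
move=> cl l0; apply: abel_inj => n; rewrite abel0 cl.
elim: l {cl} 0%N l0 => //= z l IH b /andP[/eqP-> /IH->].
by rewrite mul0r add0r.
Qed.

Lemma eq_represents c d l : c =1 d -> represents c l -> represents d l.
Proof. by move=> cd cl n; rewrite -(eq_abel cd) cl. Qed.

Lemma representsD c d l m : represents c l -> represents d m ->
  represents (fun k => c k + d k) (add_coefs l m).
Proof. by move=> cl dm n; rewrite abelD cl dm rising_comb_add. Qed.

Lemma representsZ z c l : represents c l ->
  represents (fun k => ofZ z * c k) (scale_coefs z l).
Proof. by move=> cl n; rewrite abelZ cl rising_comb_scale. Qed.

Lemma represents_succ c l : represents c l ->
  represents (fun k => k.+1%:R * c k) (times_succ 0 l).
Proof.
move=> cl; elim=> [|n IH]; last by rewrite abel_succ cl IH rising_comb_succ.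
by rewrite rising_comb_succ0 -cl !abel_n0 mul1r.
Qed.

Definition times_factor (i : nat) (l : seq Z) : seq Z :=
  add_coefs (times_succ 0 l) (scale_coefs (Z.opp (Z.of_nat i)) l).

(* [(z, [:: i_1; ...; i_r])] stands for [z * (X - i_1) * ... * (X - i_r)]. *)
Definition weighted_factors := (Z * seq nat)%type.

Definition eval_terms (e : seq weighted_factors) (x : R) : R :=
  foldr (fun t y => ofZ t.1 * (foldr (fun i z => (x - i%:R) * z) 1 t.2) + y) 0 e.

Definition times_terms (e : seq weighted_factors) (l : seq Z) : seq Z :=
  foldr (fun t m => add_coefs (scale_coefs t.1 (foldr times_factor l t.2)) m) [::] e.

Lemma represents_factor i c l : represents c l ->
  represents (fun k => (k.+1%:R - i%:R) * c k) (times_factor i l).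
Proof.
move=> cl; have := representsD (represents_succ cl)
  (representsZ (Z.opp (Z.of_nat i)) cl).
by apply: eq_represents => k; rewrite ofZN ofZ_nat -mulrDl.
Qed.

Lemma represents_terms e c l : represents c l ->
  represents (fun k => eval_terms e k.+1%:R * c k) (times_terms e l).
Proof.
move=> cl; elim: e => [n|[z s] e IH] /=.
  by rewrite (eq_abel (fun k => mul0r _)) abel0.
have cs : represents
    (fun k => foldr (fun i y => (k.+1%:R - i%:R) * y) 1 s * c k) (foldr times_factor l s).
  elim: s => [|i s IHs] /=; first by apply: eq_represents cl => k; rewrite mul1r.
  by apply: eq_represents (represents_factor i IHs) => k; rewrite mulrA.
apply: eq_represents (representsD (representsZ z cs) IH) => k.
by rewrite mulrDl mulrA.
Qed.

(* Multiplication by [x]: [u^b |-> u^b - u^(b-1)]; it is correct only when [u^0]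
   has coefficient [0]. *)
Definition times_x (l : seq Z) : seq Z :=
  add_coefs l (scale_coefs ((-1)%BZ) (behead l)).

(** Tests the side condition of [times_x] before each of [j] successive multiplications. *)
Fixpoint shiftable (j : nat) (l : seq Z) : bool :=
  if j is j'.+1 then (head 0%BZ l == 0%BZ) && shiftable j' (times_x l)
  else true.

Lemma rising_comb_times_x0 l : head 0%BZ l = 0%BZ ->
  rising_comb 0 (times_x l) 0 = 0.
Proof.
have E0 b m : rising_comb b.+1 m 0 = rising_comb b m 0.
  by elim: m b => //= z m IH b; rewrite IH !rising_n0.
case: l => //= z l ->; rewrite rising_comb_add rising_comb_scale /= E0.
by rewrite -[ofZ _]/0 -[ofZ _]/(-1); ring.
Qed.

Lemma rising_comb_times_x l n : head 0%BZ l = 0%BZ ->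
  n.+1%:R * rising_comb 0 l n = rising_comb 0 (times_x l) n.+1.
Proof.
have E b m : n.+1%:R * rising_comb b.+1 m n =
    rising_comb b.+1 m n.+1 - rising_comb b m n.+1.
  elim: m b => [|z m IH] b /=; first by rewrite mulr0 subr0.
  by rewrite mulrDr IH [_ * (_ * rising _ _)]mulrCA risingS; ring.
case: l => [|z l]; first by rewrite /= mulr0.
move=> /= ->; rewrite rising_comb_add rising_comb_scale /= -[ofZ 0%BZ]/0.
by rewrite -[ofZ _]/(-1) !mul0r !add0r E mulN1r.
Qed.

(** Multiplying an exponential generating function by [x^j] shifts its sequence by [j] and brings
    out a falling factorial. *)
Lemma ffact_rising_comb j l n : shiftable j l ->
  (n ^_ j)%:R * rising_comb 0 l (n - j) = rising_comb 0 (iter j times_x l) n.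
Proof.
elim: j l n => [|j IH] l n /=; first by rewrite mul1r subn0.
move=> /andP[/eqP l0 sl]; rewrite -iterS iterSr -IH // ffactnSr natrM -mulrA.
(* For [n <= j] the truncated difference is zero, as is the constant coefficient of a multiple of
   [x]. *)
congr (_ * _); rewrite subnS; case: (n - j)%N => [|m] /=.
  by rewrite mul0r rising_comb_times_x0.
exact: rising_comb_times_x.
Qed.

Lemma abel_shift c l j n : represents c l -> shiftable j l ->
  (n ^_ j)%:R * abel c (n - j) = rising_comb 0 (iter j times_x l) n.
Proof. by move=> cl sl; rewrite cl ffact_rising_comb. Qed.

(* The [m]-th finite difference of a monic polynomial of degree at most [m]. *)
Lemma sum_alt_bin m d c : (d <= m)%N ->
  \sum_(k < m.+1) (-1) ^+ (m - k) * (k%:R + c) ^+ d *+ 'C(m, k) =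
  (if d == m then m`!%:R else 0) :> R.
Proof.
elim: d m c => [|d IH] m c le_dm.
  transitivity ((-1 + 1) ^+ m : R).
    by rewrite exprDn; apply: eq_bigr => k _; rewrite expr0 expr1n.
  by rewrite addNr expr0n; case: m {le_dm}.
case: m le_dm => // m le_dm.
(* One factor [k + c] is split: [k] is absorbed into the binomial, lowering [m], and [c] is pulled
   out. *)
transitivity (m.+1%:R * (\sum_(k < m.+1) (-1) ^+ (m - k) * (k%:R + (1 + c)) ^+ d *+ 'C(m, k))
  + c * \sum_(k < m.+2) (-1) ^+ (m.+1 - k) * (k%:R + c) ^+ d *+ 'C(m.+1, k)).
  transitivity (\sum_(k < m.+2) k%:R * ((-1) ^+ (m.+1 - k) * (k%:R + c) ^+ d *+ 'C(m.+1, k))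
     + c * \sum_(k < m.+2) (-1) ^+ (m.+1 - k) * (k%:R + c) ^+ d *+ 'C(m.+1, k)).
    rewrite mulr_sumr -big_split; apply: eq_bigr => k _ /=.
    by rewrite -!mulrnAr -mulrDl mulrCA exprS mulrnAr !mulrnAr mulrCA mulrA.
  congr (_ + _); rewrite big_ord_recl mul0r add0r mulr_sumr.
  apply: eq_bigr => k _; rewrite lift0 subSS.
  have -> : k%:R + (1 + c) = k.+1%:R + c by rewrite -natr1 addrA.
  have mN (x y : R) p : (x * y) *+ p = x * y * p%:R by rewrite mulr_natr.
  rewrite !mN; have := mul_bin_diag m.+1 k.
  move=> /(congr1 (fun p => p%:R : R)); rewrite !natrM /= => E.
  by rewrite mulrCA [RHS]mulrCA E.
rewrite !IH ?eqSS // 1?ltnW // (ltn_eqF le_dm) mulr0 addr0.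
by case: eqP => // _; rewrite ?mulr0 // factS natrM.
Qed.

Lemma mul_bin_ffact n k j : (j <= k)%N ->
  ('C(n, k) * k ^_ j = n ^_ j * 'C(n - j, k - j))%N.
Proof.
elim: j n k => [|j IH] n k le_jk; first by rewrite !subn0 mul1n muln1.
case: k le_jk => // k le_jk; case: n => [|n]; first by rewrite bin_small.
by rewrite !ffactSS !subSS mulnCA mulnA -mul_bin_diag /= -mulnA IH // mulnA.
Qed.

(** The number [(k+1)^(k-1)] of parking functions, as a quotient to avoid a truncated exponent. *)
Definition cayley (k : nat) : R := k.+1%:R ^+ k / k.+1%:R.

(** At [n+1] the powers of [k+1] combine to [(k+1)^n], whose difference of order [n+1] vanishes. *)
Lemma represents_cayley : represents cayley [:: 1%BZ].
Proof.
move=> [|n] /=; rewrite addr0 -[ofZ _]/(1 : R) mul1r.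
  by rewrite abel_n0 rising_n0 /cayley expr0 divr1.
rewrite /rising big_ord_recl mul0n mulr0n.
have := @sum_alt_bin n.+1 n 1 (leqnSn n); rewrite ltn_eqF // => <-.
apply: eq_bigr => -[k le_kn] _ /=.
rewrite natr1 exprNn mulrCA; congr (_ * _ *+ _).
by rewrite /cayley mulrAC -exprD subnKC // exprSr mulfK ?pnatr_eq0.
Qed.

(* Ramanujan's Q-function, up to normalization. *)
Definition ramanujan (k : nat) : R :=
  k`!%:R * \sum_(j < k.+1) k.+1%:R ^+ j / j`!%:R.

Lemma ramanujan_ffact k n : (k <= n)%N ->
  ramanujan k = \sum_(j < n.+1) (k ^_ j)%:R * k.+1%:R ^+ (k - j).
Proof.
move=> le_kn; pose t j : R := (k ^_ j)%:R * k.+1%:R ^+ (k - j).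
transitivity (\sum_(j < k.+1) t j).
  rewrite /ramanujan mulr_sumr (reindex_inj rev_ord_inj) /=.
  apply: eq_bigr => -[j lt_jk] _ /=; rewrite subSS mulrCA mulrC; congr (_ * _).
  by rewrite -(ffact_fact (ltnSE lt_jk)) natrM mulfK // pnatr_eq0 -lt0n fact_gt0.
rewrite (big_ord_widen _ t (_ : k < n.+1)%N) // big_mkcond /=.
by apply: eq_bigr => j _; case: ltnP => // ?; rewrite /t ffact_small ?mul0r.
Qed.

(** For each [j], factoring out [n ^_ j] leaves the difference of order [n-j] of a monic polynomial
    of that degree, so the contribution is [n!]. The [n+1] values of [j] give [(n+1)!], the sequence
    of [u^2]. *)
Lemma represents_ramanujan :
  represents ramanujan [:: 0%BZ; 0%BZ; 1%BZ].
Proof.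
move=> n; rewrite /= -[ofZ 0%BZ]/(0 : R) -[ofZ _]/(1 : R) !mul0r mul1r !add0r addr0.
transitivity (\sum_(j < n.+1) n`!%:R : R); last first.
  rewrite sumr_const card_ord /rising -mulrnA; congr (_%:R).
  elim: n => [|n IH]; first by rewrite big_ord0.
  by rewrite big_ord_recr /= -IH add2n factS [X in (X * _)%N]mulnC.
transitivity (\sum_(j < n.+1) abel (fun k => (k ^_ j)%:R * k.+1%:R ^+ (k - j)) n : R).
  rewrite exchange_big; apply: eq_bigr => k _ /=.
  by rewrite (ramanujan_ffact (ltnSE (ltn_ord k))) mulr_suml -sumrMnl.
apply: eq_bigr => -[j lt_jn] _ /=; rewrite -(ffact_fact (ltnSE lt_jn)) natrM.
have := @sum_alt_bin (n - j) (n - j) j.+1%:R (leqnn _); rewrite eqxx => <-.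
have e : n.+1 = (j + (n - j).+1)%N by rewrite addnS subnKC.
rewrite /abel; pose t k : R := (k ^_ j)%:R * k.+1%:R ^+ (k - j) *
  (- k.+1%:R) ^+ (n - k) *+ 'C(n, k).
rewrite -[LHS]/(\sum_(k < n.+1) t k) e big_split_ord /= big1 ?add0r => [|k _]; last first.
  by rewrite /t ffact_small ?mul0r ?mul0rn.
rewrite mulr_sumr; apply: eq_bigr => -[k lt_k] _ /=; rewrite /t addKn.
have E := @mul_bin_ffact n (j + k) j (leq_addr k j); rewrite addKn in E.
have {}E : 'C(n, j + k)%:R * ((j + k) ^_ j)%:R = (n ^_ j)%:R * 'C(n - j, k)%:R :> R.
  by rewrite -!natrM E.
have {}E x : ((j + k) ^_ j)%:R * x *+ 'C(n, j + k) = (n ^_ j)%:R * (x *+ 'C(n - j, k)) :> R.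
  by rewrite -[LHS]mulr_natl -[x *+ _]mulr_natl !mulrA E.
rewrite -mulrA E; congr (_ * (_ *+ _)).
have -> : k%:R + j.+1%:R = (j + k).+1%:R :> R by rewrite -natrD addnS addnC.
rewrite exprNn mulrCA -exprD -subnDA; congr (_ * _ ^+ _).
lia.
Qed.
End RisingBasis.

Arguments times_terms : simpl never.
Arguments add_coefs : simpl never.

(** * The moments of the displacement *)

Section Moments.
Variable R : numFieldType.

Definition displacement_gf (k : nat) : {poly R} := parking_gf (1 + 'X) k.

Lemma parking_gf0 (q : {poly R}) : parking_gf q 0 = 1.
Proof. by rewrite /parking_gf /= /displacement big_nil mul1r. Qed.

(** The coefficient of [t^i] in [parking_gf_rec] at [q = 1 + t], completed by the case [n = 0]. *)
Lemma displacement_gf_rec i n :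
  \sum_(j < i.+1) (-1) ^+ j *
    abel (fun k => (displacement_gf k * qbrack_tail R k ^+ j)`_(i - j)) (n - j)
    *+ 'C(n, j) = ((i == 0%N) && (n == 0%N))%:R.
Proof.
rewrite -coef_abel_expand -abel_expand; case: n => [|n].
  by rewrite big_ord1 subnn expr0 mulr1 mulr1n /displacement_gf parking_gf0 coef1 andbT.
under eq_bigr do rewrite -sum_1X.
by rewrite (parking_gf_rec (1 + 'X : {poly R}) (ltn0Sn n)) coef0 andbF.
Qed.

Lemma represents_moment0 : represents (fun k => (displacement_gf k)`_0) [:: 1%BZ].
Proof.
move=> n; have := displacement_gf_rec 0 n; rewrite big_ord1 !subn0 mul1r bin0 mulr1n /=.
rewrite (eq_abel (d := fun k => (displacement_gf k)`_0)) => [->|k]; last by rewrite expr0 mulr1.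
rewrite -[ofZ R _]/(1 : R) mul1r addr0; case: n => [|n]; first by rewrite rising_n0.
by rewrite /rising big_ord_recl mul0n mulr0n.
Qed.

(* [nth [::] ls j] represents [D / j!] times the argument of [abel] in the [j]-th
   term of [displacement_gf_rec]; index [0] is a dummy. *)
Definition solve_moment (ls : seq (seq Z)) : seq Z :=
  foldr (fun j m => add_coefs (scale_coefs (if odd j then 1 else -1)%BZ
    (iter j (@times_x) (nth [::] ls j))) m) [::] (iota 1 (size ls).-1).

(** The term [j = 0] of [displacement_gf_rec] is the unknown moment. In the others ['C(n, j)] is
    [n ^_ j / j!], so each amounts to [j] multiplications by [x]; moving them across makes the sign
    positive for odd [j]. *)
Lemma represents_moment (D : R) (i : nat) (ls : seq (seq Z)) :
  size ls = i.+1 -> (0 < i)%N ->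
  (forall j, (0 < j <= i)%N -> shiftable j (nth [::] ls j) /\
    represents (fun k => D / j`!%:R *
      (displacement_gf k * qbrack_tail R k ^+ j)`_(i - j)) (nth [::] ls j)) ->
  represents (fun k => D * (displacement_gf k)`_i) (solve_moment ls).
Proof.
move=> sz i_gt0 Hl n; rewrite abelZ.
have := displacement_gf_rec i n; rewrite gtn_eqF //= big_ord_recl /= expr0 mul1r bin0 mulr1n !subn0.
have -> : abel (fun k => (displacement_gf k * qbrack_tail R k ^+ 0)`_i) n =
          abel (fun k => (displacement_gf k)`_i) n.
  by apply: eq_abel => k; rewrite expr0 mulr1.
move/eqP; rewrite addr_eq0 => /eqP ->; rewrite /solve_moment sz /=.
have -> (m : seq nat) (t : nat -> seq Z) :
    rising_comb R 0 (foldr (fun j m => add_coefs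
      (scale_coefs (if odd j then 1 else -1)%BZ (t j)) m) [::] m) n =
    \sum_(j <- m) (-1) ^+ (~~ odd j) * rising_comb R 0 (t j) n.
  elim: m => [|j m IH]; first by rewrite big_nil.
  rewrite big_cons /= rising_comb_add rising_comb_scale IH; congr (_ * _ + _).
  by case: (odd j).
have -> : iota 1 i = index_iota 1 i.+1 by rewrite /index_iota subn1.
rewrite big_add1 big_mkord -sumrN mulr_sumr; apply: eq_bigr => -[j lt_ji] _ /=.
have [//|sh rep] := Hl j.+1.
rewrite -(abel_shift _ rep sh) abelZ -signr_odd /=.
have f0 : (j.+1)`!%:R != 0 :> R by rewrite pnatr_eq0 -lt0n fact_gt0.
rewrite -(bin_ffact n j.+1) natrM -mulr_natr.
set x := abel _ _; set c := 'C(_, _)%:R.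
case: (odd j); rewrite /= ?expr0 ?expr1.
  by field.
by field.
Qed.

Lemma natr_ffact k j : (k ^_ j)%:R = \prod_(i < j) (k%:R - i%:R) :> R.
Proof.
elim: j k => [|j IH] k; first by rewrite big_ord0.
rewrite big_ord_recr /= -IH ffactnSr natrM.
have [le_jk|lt_kj] := leqP j k; first by rewrite natrB.
by rewrite ffact_small // !mul0r.
Qed.

Lemma natr_bin k j : 'C(k, j)%:R = \prod_(i < j) (k%:R - i%:R) / j`!%:R :> R.
Proof.
rewrite -natr_ffact -bin_ffact natrM mulfK // pnatr_eq0 -lt0n; exact: fact_gt0.
Qed.

(* [moment_list1], ..., [moment_list4] represent the moments multiplied by
   [2], [24], [48] and [5760], which clear the denominators. *)
Definition moment_list0 : seq Z := [:: 1%BZ].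

Definition moment_list1 : seq Z :=
  solve_moment [:: [::]; times_terms [:: (1%BZ, [:: 0; 1])]%N moment_list0].

(** With [X = k+1], the entries are [24 C(X,2) a_1 = 6 X(X-1) (2 a_1)], [24 C(X,3) = 4 X(X-1)(X-2)]
    and [12 C(X,2)^2 = 3 X^2 (X-1)^2]. The later lists follow the same pattern. *)
Definition moment_list2 : seq Z :=
  solve_moment [:: [::];
    add_coefs (times_terms [:: (6%BZ, [:: 0; 1])]%N moment_list1)
         (times_terms [:: (4%BZ, [:: 0; 1; 2])]%N moment_list0);
    times_terms [:: (3%BZ, [:: 0; 0; 1; 1])]%N moment_list0].

Definition moment_list3 : seq Z :=
  solve_moment [:: [::];
    add_coefs (times_terms [:: (2%BZ, [:: 0; 1; 2; 3])]%N moment_list0)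
   (add_coefs (times_terms [:: (4%BZ, [:: 0; 1; 2])]%N moment_list1)
         (times_terms [:: (1%BZ, [:: 0; 1])]%N moment_list2));
    add_coefs (times_terms [:: (4%BZ, [:: 0; 0; 1; 1; 2])]%N moment_list0)
         (times_terms [:: (3%BZ, [:: 0; 0; 1; 1])]%N moment_list1);
    times_terms [:: (1%BZ, [:: 0; 0; 0; 1; 1; 1])]%N moment_list0].

Definition moment_list4 : seq Z :=
  solve_moment [:: [::];
    add_coefs (times_terms [:: (48%BZ, [:: 0; 1; 2; 3; 4])]%N moment_list0)
   (add_coefs (times_terms [:: (120%BZ, [:: 0; 1; 2; 3])]%N moment_list1)
   (add_coefs (times_terms [:: (40%BZ, [:: 0; 1; 2])]%N moment_list2)
         (times_terms [:: (60%BZ, [:: 0; 1])]%N moment_list3)));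
    add_coefs (times_terms [:: (120%BZ, [:: 0; 0; 1; 1; 2; 3]); (80%BZ, [:: 0; 0; 1; 1; 2; 2])]%N moment_list0)
   (add_coefs (times_terms [:: (240%BZ, [:: 0; 0; 1; 1; 2])]%N moment_list1)
         (times_terms [:: (30%BZ, [:: 0; 0; 1; 1])]%N moment_list2));
    add_coefs (times_terms [:: (120%BZ, [:: 0; 0; 0; 1; 1; 1; 2])]%N moment_list0)
         (times_terms [:: (60%BZ, [:: 0; 0; 0; 1; 1; 1])]%N moment_list1);
    times_terms [:: (15%BZ, [:: 0; 0; 0; 0; 1; 1; 1; 1])]%N moment_list0].

Lemma natr_bin2 k : 'C(k, 2)%:R = k%:R * (k%:R - 1) / 2 :> R.
Proof. by rewrite natr_bin !big_ord_recl big_ord0 !lift0 subr0 mulr1. Qed.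

Lemma natr_bin3 k : 'C(k, 3)%:R = k%:R * (k%:R - 1) * (k%:R - 2) / 6 :> R.
Proof. by rewrite natr_bin !big_ord_recl big_ord0 !lift0 subr0 mulr1 !mulrA. Qed.

Lemma natr_bin4 k : 'C(k, 4)%:R =
  k%:R * (k%:R - 1) * (k%:R - 2) * (k%:R - 3) / 24 :> R.
Proof. by rewrite natr_bin !big_ord_recl big_ord0 !lift0 subr0 mulr1 !mulrA. Qed.

Lemma natr_bin5 k : 'C(k, 5)%:R =
  k%:R * (k%:R - 1) * (k%:R - 2) * (k%:R - 3) * (k%:R - 4) / 120 :> R.
Proof. by rewrite natr_bin !big_ord_recl big_ord0 !lift0 subr0 mulr1 !mulrA. Qed.

Ltac moment_coefficients :=
  rewrite /= ?ofZ_pos /= ?exprS !expr0 ?mulr1;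
  rewrite ?(coefM, big_ord_recl, big_ord0) /= ?subn0 ?subSS /= ?coef_qbrack_tail
    ?(natr_bin2, natr_bin3, natr_bin4, natr_bin5) ?factS ?fact0.

Lemma represents_moment1 :
  represents (fun k => 2 * (displacement_gf k)`_1) moment_list1.
Proof.
(* Here [vm_compute] verifies [shiftable]. *)
apply: (@represents_moment 2 1) => // -[|[|j]] // _; (split; first by vm_compute); rewrite /=.
apply: eq_represents (represents_terms _ represents_moment0) => k.
by moment_coefficients; field.
Qed.

Lemma represents_moment2 : represents (fun k => 24 * (displacement_gf k)`_2) moment_list2.
Proof.
apply: (@represents_moment 24 2) => // -[|[|[|j]]] // _; (split; first by vm_compute); rewrite /=.
  apply: eq_represents (representsD (represents_terms _ represents_moment1)
    (represents_terms _ represents_moment0)) => k.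
  moment_coefficients.
  by field.
apply: eq_represents (represents_terms _ represents_moment0) => k.
by moment_coefficients; field.
Qed.

Lemma represents_moment3 :
  represents (fun k => 48 * (displacement_gf k)`_3) moment_list3.
Proof.
have [r0 r1 r2] := And3 represents_moment0 represents_moment1 represents_moment2.
apply: (@represents_moment 48 3) => // -[|[|[|[|j]]]] // _;
  (split; first by vm_compute); rewrite /=.
- apply: eq_represents (representsD (represents_terms _ r0)
    (representsD (represents_terms _ r1) (represents_terms _ r2))) => k.
  by moment_coefficients; field.
- apply: eq_represents (representsD (represents_terms _ r0)
    (represents_terms _ r1)) => k.
  by moment_coefficients; field.
- apply: eq_represents (represents_terms _ r0) => k.
  by moment_coefficients; field.
Qed.

Lemma represents_moment4 :
  represents (fun k => 5760 * (displacement_gf k)`_4) moment_list4.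
Proof.
have [r0 r1 r2] := And3 represents_moment0 represents_moment1 represents_moment2.
have r3 := represents_moment3.
apply: (@represents_moment 5760 4) => // -[|[|[|[|[|j]]]]] // _;
  (split; first by vm_compute); rewrite /=.
- apply: eq_represents (representsD (represents_terms _ r0)
    (representsD (represents_terms _ r1) (representsD (represents_terms _ r2)
    (represents_terms _ r3)))) => k.
  by moment_coefficients; field.
- apply: eq_represents (representsD (represents_terms _ r0)
    (representsD (represents_terms _ r1) (represents_terms _ r2))) => k.
  by moment_coefficients; field.
- apply: eq_represents (representsD (represents_terms _ r0)
    (represents_terms _ r1)) => k.
  by moment_coefficients; field.
- apply: eq_represents (represents_terms _ r0) => k.
  by moment_coefficients; field.
Qed.

End Moments.

(** * The fourth moment of the area *)

Section Fourth.
Variable R : realFieldType.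

(* Binary numerals, since [lra] and [field] expand large [nat] literals in unary. *)
Lemma natr_pos_val (n : nat) (p : positive) :
  Z.of_nat n = Zpos p -> n%:R = pos_val R p.
Proof. by move=> np; rewrite -ofZ_pos -np ofZ_nat. Qed.

(** Both sequences have transform [1], which counts the parking functions. *)
Lemma displacement_gf0 : (fun k => (displacement_gf R k)`_0) =1 cayley R.
Proof. exact: represents_inj (represents_moment0 R) (represents_cayley R). Qed.

(* The sum of the areas of the parking functions of length [k]; see [E1_cayley]. *)
Definition area_moment1 (k : nat) : R :=
  (ramanujan R k - (2 * k.+1%:R - 1) * cayley R k) / 2.

Definition area_moment1_list : seq Z :=
  add_coefs (times_terms [:: (1, [::])]%BZ [:: 0; 0; 1]%BZ)
       (times_terms [:: (-2, [:: 0%N]); (1, [::])]%BZ moment_list0).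

Lemma represents_area_moment1 :
  represents (fun k => 2 * area_moment1 k) area_moment1_list.
Proof.
apply: eq_represents (representsD (represents_terms _ (represents_ramanujan R))
  (represents_terms _ (represents_cayley R))) => k.
rewrite /= !ofZ_neg !ofZ_pos /area_moment1 /=; by field.
Qed.

(* Both sides of [fourth_moment_identity], the second one negated, multiplied by
   [60480]; the factors [1] and [2] stand for [n] and [n - 1], so that [:: 1; 2]
   is twice [N = n (n - 1) / 2]. *)
Definition fourth_lhs : seq Z :=
  add_coefs (times_terms [:: (-181440, [:: 1; 2]%N); (166320, [:: 1; 2; 1; 2]%N);
                   (-45360, [:: 1; 2; 1; 2; 1; 2]%N);
                   (3780, [:: 1; 2; 1; 2; 1; 2; 1; 2]%N)]%BZ moment_list0)
 (add_coefs (times_terms [:: (725760, [::]); (-665280, [:: 1; 2]%N);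
                   (181440, [:: 1; 2; 1; 2]%N);
                   (-15120, [:: 1; 2; 1; 2; 1; 2]%N)]%BZ moment_list1)
 (add_coefs (times_terms [:: (181440, [::]); (-75600, [:: 1; 2]%N);
                   (7560, [:: 1; 2; 1; 2]%N)]%BZ moment_list2)
 (add_coefs (times_terms [:: (90720, [::]); (-15120, [:: 1; 2]%N)]%BZ moment_list3)
       (times_terms [:: (252, [::])]%BZ moment_list4)))).

Definition fourth_rhs : seq Z :=
  add_coefs (times_terms [:: (-13260, nseq 6 1%N); (-127474, nseq 5 1%N);
                   (-407588, nseq 4 1%N); (-266604, nseq 3 1%N);
                   (440000, nseq 2 1%N); (374926, nseq 1 1%N)]%BZ moment_list0)
       (times_terms [:: (66150, nseq 4 1%N); (502880, nseq 3 1%N);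
                   (1562916, nseq 2 1%N); (2133792, nseq 1 1%N);
                   (1007606, [::])]%BZ area_moment1_list).

Lemma fourth_lhs_rhs : all (pred1 0%BZ) (add_coefs fourth_lhs fourth_rhs).
Proof. by vm_compute. Qed.

(** The fourth moment formula multiplied by the number of parking functions; the left side is
    identified in [area_factorial_momentE]. *)
Lemma fourth_moment_identity (n : nat) :
  let a i := (displacement_gf R n)`_i in
  let N : R := n%:R * (n%:R - 1) / 2 in
  N * (N - 1) * (N - 2) * (N - 3) * a 0%N
  - 4 * (N - 1) * (N - 2) * (N - 3) * a 1%N
  + 12 * (N - 2) * (N - 3) * a 2%N - 24 * (N - 3) * a 3%N + 24 * a 4%N =
  (221 / 1008 * n%:R ^+ 6 + 63737%N%:R / 30240%N%:R * n%:R ^+ 5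
       + 101897%N%:R / 15120%N%:R * n%:R ^+ 4 + 22217%N%:R / 5040%N%:R * n%:R ^+ 3
       - 1375 / 189 * n%:R ^+ 2 - 187463%N%:R / 30240%N%:R * n%:R) * cayley R n
       + (- (35 / 16) * n%:R ^+ 4 - 449 / 27 * n%:R ^+ 3
          - 130243%N%:R / 2520 * n%:R ^+ 2 - 7409%N%:R / 105 * n%:R
          - 503803%N%:R / 15120%N%:R) * area_moment1 n.
Proof.
have := represents_zero (representsD (representsD (represents_terms _ (represents_moment0 R))
  (representsD (represents_terms _ (represents_moment1 R))
  (representsD (represents_terms _ (represents_moment2 R))
  (representsD (represents_terms _ (represents_moment3 R))
     (represents_terms _ (represents_moment4 R))))))
  (representsD (represents_terms _ (represents_cayley R))
     (represents_terms _ represents_area_moment1))) fourth_lhs_rhs n.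
rewrite /= -!displacement_gf0 !ofZ_neg !ofZ_pos /= -[n.+1%:R]natr1.
move: (_`_0) (_`_1) (_`_2) (_`_3) (_`_4) (area_moment1 n) n%:R => a0 a1 a2 a3 a4 e x E.
have e63737 : 63737%N%:R = pos_val R 63737 by apply: natr_pos_val; vm_compute.
have e30240 : 30240%N%:R = pos_val R 30240 by apply: natr_pos_val; vm_compute.
have e101897 : 101897%N%:R = pos_val R 101897 by apply: natr_pos_val; vm_compute.
have e15120 : 15120%N%:R = pos_val R 15120 by apply: natr_pos_val; vm_compute.
have e22217 : 22217%N%:R = pos_val R 22217 by apply: natr_pos_val; vm_compute.
have e5040 : 5040%N%:R = pos_val R 5040 by apply: natr_pos_val; vm_compute.
have e187463 : 187463%N%:R = pos_val R 187463 by apply: natr_pos_val; vm_compute.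
have e130243 : 130243%N%:R = pos_val R 130243 by apply: natr_pos_val; vm_compute.
have e7409 : 7409%N%:R = pos_val R 7409 by apply: natr_pos_val; vm_compute.
have e503803 : 503803%N%:R = pos_val R 503803 by apply: natr_pos_val; vm_compute.
rewrite ?e63737 ?e30240 ?e101897 ?e15120 ?e22217 ?e5040 ?e187463 ?e130243 ?e7409 ?e503803 /=.
clear e63737 e30240 e101897 e15120 e22217 e5040 e187463 e130243 e7409 e503803.
(* The scaling [60480] of [fourth_lhs], written with small literals. *)
have c0 : 64 * 945 != 0 :> R by rewrite mulf_neq0 ?pnatr_eq0.
apply: (mulfI c0); apply/eqP; rewrite -subr_eq0 -E; apply/eqP.
by field.

Qed.
End Fourth.

(** * From the displacement to the area *)

Lemma is_parking_functionE n (p : n.-tuple nat) :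
  is_parking_function p = parking_word p.
Proof.
rewrite /is_parking_function /parking_word size_tuple; congr andb.
apply/forallP/allP => [Hp i|Hp i]; last by apply: Hp; rewrite mem_iota /=.
by rewrite mem_iota add0n => /andP[_ lt_in]; apply: (Hp (Ordinal lt_in)).
Qed.

Section Link.
Variable R : realFieldType.

Lemma coef_displacement_gf i n :
  (displacement_gf R n)`_i =
  \sum_(p in parking_functions n) 'C(displacement (map val p), i)%:R.
Proof.
rewrite /displacement_gf /parking_gf -val_enum_ord wsum_map -sum_tuple_wsum.
rewrite coef_sum [RHS]big_mkcond; apply: eq_bigr => p _.
rewrite inE is_parking_functionE /=.
by case: parking_word; rewrite ?mul1r ?mul0r ?coef0 // coef_1X.
Qed.

(** Lowering each of the [n] letters by one turns [n(n+1)/2] into [n(n-1)/2]. *)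
Lemma areaE n (p : n.-tuple 'I_n.+1) : p \in parking_functions n ->
  (area p)%:~R = n%:R * (n%:R - 1) / 2 - (displacement (map val p))%:R :> R.
Proof.
rewrite inE is_parking_functionE => /andP[/allP p_gt0 _].
have S : (displacement (map val p) + n = \sum_(i < n) tnth p i)%N.
  rewrite /displacement big_map big_tuple -[X in (_ + X)%N]card_ord -sum1_card.
  rewrite -big_split; apply: eq_bigr => i _ /=; rewrite addn1 prednK //.
  by apply: p_gt0; rewrite /= map_f // mem_tnth.
rewrite /area rmorphB -(big_morph Posz PoszD (erefl _)) -S /= -!pmulrn natrD.
have E : ((n * n.+1)./2 * 2 = n * n.+1)%N.
  by rewrite muln2 halfK oddM /= andbN subn0.
have {}E : ((n * n.+1)./2)%:R = n%:R * (n%:R + 1) / 2 :> R.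
  have := congr1 (fun m => m%:R : R) E; rewrite !natrM -[n.+1%:R]natr1 => <-.
  by rewrite mulfK // pnatr_eq0.
by rewrite E; field.
Qed.

(** Newton's expansion, in binomials of [S], of the falling factorial of order four of [N - S]. *)
Lemma area_factorial_momentE n :
  area_factorial_moment R n 4 * cayley R n =
  let a i := (displacement_gf R n)`_i in
  let N : R := n%:R * (n%:R - 1) / 2 in
  N * (N - 1) * (N - 2) * (N - 3) * a 0%N
  - 4 * (N - 1) * (N - 2) * (N - 3) * a 1%N
  + 12 * (N - 2) * (N - 3) * a 2%N - 24 * (N - 3) * a 3%N + 24 * a 4%N.
Proof.
pose N : R := n%:R * (n%:R - 1) / 2.
have card_pf : #|parking_functions n|%:R = cayley R n.
  rewrite -displacement_gf0 coef_displacement_gf -sum1_card natr_sum.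
  by apply: eq_bigr => p _; rewrite bin0.
have c0 : cayley R n != 0.
  by rewrite /cayley mulf_neq0 ?invr_eq0 ?expf_neq0 // pnatr_eq0.
rewrite /area_factorial_moment /uniform_expectation card_pf divfK //.
transitivity (\sum_(p in parking_functions n)
  let c i := 'C(displacement (map val p), i)%:R in
  (N * (N - 1) * (N - 2) * (N - 3) * c 0%N - 4 * (N - 1) * (N - 2) * (N - 3) * c 1%N
   + 12 * (N - 2) * (N - 3) * c 2%N - 24 * (N - 3) * c 3%N + 24 * c 4%N)); last first.
  rewrite /= !big_split /= !sumrN -!mulr_sumr.
  by rewrite !coef_displacement_gf.
apply: eq_bigr => p /areaE-> /=; rewrite -/N.
rewrite bin0 bin1 natr_bin2 natr_bin3 natr_bin4 !big_ord_recl big_ord0 !lift0 /=.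
move: N (displacement _)%:R => N S; by field.
Qed.

End Link.

(** The sum in [ramanujan] has one more term than that in [E1]; this last term contributes
    [(n+1)^n], that is [n+1] times [cayley R n]. *)
Lemma E1_cayley (R : realFieldType) n : E1 R n * cayley R n = area_moment1 R n.
Proof.
rewrite /area_moment1 /ramanujan /E1 /cayley big_ord_recr /= mulrDr.
rewrite [_`!%:R * (_ / _)]mulrCA divff ?mulr1; last first.
  by rewrite pnatr_eq0 -lt0n fact_gt0.
rewrite big_mkord factS natrM; set s := \sum_(_ < n) _.
have K0 : n.+1%:R != 0 :> R by rewrite pnatr_eq0.
have -> : n%:R = n.+1%:R - 1 :> R by rewrite -natr1 addrK.
move: n.+1%:R K0 n`!%:R => K K0 f.
by field; rewrite K0 expf_neq0.
Qed.

Lemma area_moment4 (R : realFieldType) n :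
  area_factorial_moment R n 4 =
       221 / 1008 * n%:R ^+ 6 + 63737%N%:R / 30240%N%:R * n%:R ^+ 5
       + 101897%N%:R / 15120%N%:R * n%:R ^+ 4 + 22217%N%:R / 5040%N%:R * n%:R ^+ 3
       - 1375 / 189 * n%:R ^+ 2 - 187463%N%:R / 30240%N%:R * n%:R
       + (- (35 / 16) * n%:R ^+ 4 - 449 / 27 * n%:R ^+ 3
          - 130243%N%:R / 2520 * n%:R ^+ 2 - 7409%N%:R / 105 * n%:R
          - 503803%N%:R / 15120%N%:R) * E1 R n.
Proof.
have c0 : cayley R n != 0.
  by rewrite /cayley mulf_neq0 ?invr_eq0 ?expf_neq0 // pnatr_eq0.
apply: (mulIf c0); rewrite [RHS]mulrDl -[X in _ = _ + X]mulrA E1_cayley.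
exact: etrans (area_factorial_momentE R n) (fourth_moment_identity R n).
Qed.

(** * Asymptotics *)

Section Bound.
Variable R : rcfType.

(** Induction on [J]. As each [r_j <= 1], the square grows by at most [(2J+1) r_J], and the right
    side by [2N (r_J - r_(J+1)) = 2(J+1) r_J]. *)
Lemma sqr_sum_ffact n J : (J <= n.+1)%N ->
  (\sum_(j < J) (n ^_ j)%:R / n.+1%:R ^+ j) ^+ 2 <=
  2 * n.+1%:R * (1 - (n ^_ J)%:R / n.+1%:R ^+ J) :> R.
Proof.
have N0 : 0 < n.+1%:R :> R by rewrite ltr0n.
pose r j : R := (n ^_ j)%:R / n.+1%:R ^+ j.
have r_ge0 j : 0 <= r j by rewrite divr_ge0 ?exprn_ge0 ?ler0n.
have rS j : (j <= n)%N -> n.+1%:R * r j.+1 = r j * (n.+1%:R - j.+1%:R).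
  move=> le_jn; rewrite /r ffactnSr natrM natrB // exprS -!natr1.
  have N1 : n%:R + 1 != 0 :> R by rewrite natr1 pnatr_eq0.
  have := expf_neq0 j N1; set P := _ ^+ j => P0.
  by field; rewrite N1 P0.
have r_le1 j : (j <= n.+1)%N -> r j <= 1.
  elim: j => [|j IH] le_jn; first by rewrite /r divr1.
  rewrite -(ler_pM2l N0) rS // mulrBr mulrC.
  have h : n.+1%:R * r j <= n.+1%:R * 1 by rewrite ler_pM2l // IH // ltnW.
  by apply: le_trans h; rewrite lerBlDr lerDl mulr_ge0.
rewrite -[X in _ - X]/(r J).
have -> : \sum_(j < J) (n ^_ j)%:R / n.+1%:R ^+ j = \sum_(j < J) r j by [].
elim: J => [|J IH] le_Jn; first by rewrite big_ord0 /r divr1 expr0n subrr mulr0.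
have {}IH := IH (ltnW le_Jn); rewrite big_ord_recr /=.
have S_le : \sum_(j < J) r j <= J%:R.
  rewrite -[leRHS]mulr_natr mul1r -[J in J%:R]card_ord -sumr_const.
  by apply: ler_sum => j _; apply: r_le1; rewrite (leq_trans (ltnW (ltn_ord j))) // ltnW.
have := rS J le_Jn; have := r_ge0 J; have := r_le1 J (ltnW le_Jn).
move: IH S_le; rewrite -[J.+1%:R]natr1.
move: (\sum_(j < J) _) (r J) (r J.+1) n.+1%:R J%:R => S x y N j IH S_le x1 x0 E.
have : x * S <= x * j by apply: ler_wpM2l.
have : x * x <= x * 1 by apply: ler_wpM2l.
by move: IH E; rewrite !expr2; lra.
Qed.

Lemma E1_ffact n : E1 R n =
  (n.+1%:R * \sum_(j < n.+1) (n ^_ j)%:R / n.+1%:R ^+ j - 2 * n.+1%:R + 1) / 2.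
Proof.
have N0 : n.+1%:R != 0 :> R by rewrite pnatr_eq0.
have P0 : n.+1%:R ^+ n != 0 :> R by rewrite expf_neq0.
have c0 : cayley R n != 0 by rewrite /cayley mulf_neq0 ?invr_eq0.
apply: (mulIf c0); rewrite E1_cayley /area_moment1 (ramanujan_ffact _ (leqnn n)).
have -> : \sum_(j < n.+1) (n ^_ j)%:R * n.+1%:R ^+ (n - j) =
   n.+1%:R ^+ n * \sum_(j < n.+1) (n ^_ j)%:R / n.+1%:R ^+ j :> R.
  rewrite mulr_sumr; apply: eq_bigr => -[j lt_jn] _ /=.
  by rewrite [RHS]mulrCA -expfB_cond // (negPf N0) add0n -ltnS.
rewrite /cayley; set S := \sum_(_ < _) _.
by move: {P0 c0}N0; move: n.+1%:R => N N0; field; rewrite ?N0 ?expf_neq0.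
Qed.

(** Since [S >= 1], [E1] is at most [N S] in absolute value, and [(N S)^2 <= 2 N^3 <= 2 (2n)^3 = (4
    n sqrt n)^2]. *)
Lemma norm_E1_le n : (0 < n)%N -> `|E1 R n| <= 4 * (n%:R * Num.sqrt n%:R).
Proof.
move=> n_gt0; have n1 : 1 <= n%:R :> R by rewrite ler1n.
have n0 : 0 <= n%:R :> R by lra.
rewrite -[X in _ <= X]ger0_norm ?mulr_ge0 ?sqrtr_ge0 //.
rewrite -ler_sqr ?nnegrE ?normr_ge0 // -!normrX ger0_norm ?sqr_ge0 //.
rewrite ger0_norm ?sqr_ge0 // !exprMn sqr_sqrtr // E1_ffact.
have := sqr_sum_ffact (leqnn n.+1); rewrite ffact_small // mul0r subr0 mulr1.
have S1 : 1 <= \sum_(j < n.+1) (n ^_ j)%:R / n.+1%:R ^+ j :> R.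
  by rewrite big_ord_recl divr1 lerDl sumr_ge0.
move: S1; set S := \sum_(j < n.+1) _; move: S => S.
rewrite -[n.+1%:R]natr1; move: n%:R n1 {n0} => x x1 S1 SS.
apply: (@le_trans _ _ (((x + 1) * S) ^+ 2)).
  have : 0 <= (x + 1) * (S - 1) by rewrite mulr_ge0 //; lra.
  rewrite -subr_ge0 => p; nra.
have h : (x + 1) ^+ 2 * S ^+ 2 <= (x + 1) ^+ 2 * (2 * (x + 1)) by rewrite ler_wpM2l ?sqr_ge0.
rewrite exprMn (le_trans h) //.
have : (x + 1) ^+ 3 <= (2 * x) ^+ 3 by rewrite lerXn2r ?nnegrE //; lra.
by lra.
Qed.

End Bound.

Lemma powR11_2 (R : realType) (x : R) : 0 < x ->
  x `^ (11 / 2) = x ^+ 5 * Num.sqrt x.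
Proof.
move=> x_gt0; have -> : 11 / 2 = 5%:R + 2^-1 :> R by lra.
rewrite powRD ?(gt_eqF x_gt0) ?implybT // powR_mulrn ?ltW //.
by rewrite powR12_sqrt // ltW.
Qed.

(** Here [y] stands for [sqrt n]. The bounds on the [c_i] add up to [30] and those on the [d_i] to
    [177], so the constant is [30 + 4 * 177 = 738]. *)
Lemma norm_error_le (R : realFieldType) (x y e c5 c4 c3 c2 c1 d4 d3 d2 d1 d0 : R) :
  1 <= x -> 1 <= y -> `|e| <= 4 * (x * y) ->
  0 <= c5 <= 3 -> 0 <= c4 <= 7 -> 0 <= c3 <= 5 -> 0 <= c2 <= 8 -> 0 <= c1 <= 7 ->
  0 <= d4 <= 3 -> 0 <= d3 <= 17 -> 0 <= d2 <= 52 -> 0 <= d1 <= 71 -> 0 <= d0 <= 34 ->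
  `|c5 * x ^+ 5 + c4 * x ^+ 4 + c3 * x ^+ 3 - c2 * x ^+ 2 - c1 * x
    + (- d4 * x ^+ 4 - d3 * x ^+ 3 - d2 * x ^+ 2 - d1 * x - d0) * e|
  <= 738 * (x ^+ 5 * y).
Proof.
move=> x1 y1 e_le hc5 hc4 hc3 hc2 hc1 hd4 hd3 hd2 hd1 hd0.
have x0 : 0 <= x by lra.
have mono c M i j : 0 <= c <= M -> (i <= j)%N -> 0 <= c * x ^+ i <= M * x ^+ j.
  move=> /andP[c0 cM] le_ij; rewrite mulr_ge0 ?exprn_ge0 //=.
  by rewrite ler_pM ?exprn_ge0 // ler_weXn2l.
have A : `|c5 * x ^+ 5 + c4 * x ^+ 4 + c3 * x ^+ 3 - c2 * x ^+ 2 - c1 * x| <= 30 * x ^+ 5.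
  have := mono _ _ 5 5 hc5 isT; have := mono _ _ 4 5 hc4 isT.
  have := mono _ _ 3 5 hc3 isT; have := mono _ _ 2 5 hc2 isT.
  have := mono _ _ 1 5 hc1 isT; rewrite expr1 ler_norml => *.
  by lra.
have B : `|- d4 * x ^+ 4 - d3 * x ^+ 3 - d2 * x ^+ 2 - d1 * x - d0| <= 177 * x ^+ 4.
  have := mono _ _ 4 4 hd4 isT; have := mono _ _ 3 4 hd3 isT.
  have := mono _ _ 2 4 hd2 isT; have := mono _ _ 1 4 hd1 isT.
  have := mono _ _ 0 4 hd0 isT; rewrite expr1 expr0 mulr1 ler_norml mulNr => *.
  by lra.
apply: le_trans (ler_normD _ _) _; rewrite normrM.
have := ler_pM (normr_ge0 _) (normr_ge0 _) B e_le.
have : x ^+ 5 * 1 <= x ^+ 5 * y by rewrite ler_wpM2l ?exprn_ge0.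
have -> : 177 * x ^+ 4 * (4 * (x * y)) = 708 * (x ^+ 5 * y) by ring.
by move: A; lra.
Qed.

Lemma ratio_le (R : realFieldType) (a b m : nat) :
  (0 < b)%N -> (a <= m * b)%N -> 0 <= (a%:R / b%:R : R) <= m%:R.
Proof.
move=> b0 ab; rewrite divr_ge0 ?ler0n //= ler_pdivrMr ?ltr0n //.
by rewrite -natrM ler_nat.
Qed.

Theorem theorem4 (R : realType) :
  (forall n : nat, (1 <= n)%N ->
     area_factorial_moment R n 4 =
       221 / 1008 * n%:R ^+ 6 + 63737%N%:R / 30240%N%:R * n%:R ^+ 5
       + 101897%N%:R / 15120%N%:R * n%:R ^+ 4 + 22217%N%:R / 5040%N%:R * n%:R ^+ 3
       - 1375 / 189 * n%:R ^+ 2 - 187463%N%:R / 30240%N%:R * n%:R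
       + (- (35 / 16) * n%:R ^+ 4 - 449 / 27 * n%:R ^+ 3
          - 130243%N%:R / 2520 * n%:R ^+ 2 - 7409%N%:R / 105 * n%:R
          - 503803%N%:R / 15120%N%:R) * E1 R n) /\
  (fun n : nat => area_factorial_moment R n 4) =
    (fun n : nat => 221 / 1008 * n%:R ^+ 6)
    +O_\oo (fun n : nat => n%:R `^ (11 / 2)).
Proof.
split=> [n _|]; first exact: area_moment4.
apply/eqaddOP; near=> k; near=> n.
have n_gt0 : (0 < n)%N by near: n; exact: nbhs_infty_gt.
have x1 : 1 <= n%:R :> R by rewrite ler1n.
have -> : ((fun n : nat => area_factorial_moment R n 4) -
    (fun n : nat => 221 / 1008 * n%:R ^+ 6)) n =
  area_factorial_moment R n 4 - 221 / 1008 * n%:R ^+ 6 by [].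
rewrite area_moment4 powR11_2 ?ltr0n //.
rewrite [X in _ <= _ * X]ger0_norm ?mulr_ge0 ?exprn_ge0 ?sqrtr_ge0 //.
have k738 : 738 <= k by near: k; apply: nbhs_pinfty_ge; exact: num_real.
apply: le_trans (ler_wpM2r _ k738); last by rewrite mulr_ge0 ?exprn_ge0 ?sqrtr_ge0.
have y1 : 1 <= Num.sqrt n%:R :> R by rewrite -[leLHS]sqrtr1 ler_wsqrtr.
have := @norm_error_le R n%:R (Num.sqrt n%:R) (E1 R n)
  _ _ _ _ _ _ _ _ _ _ x1 y1 (norm_E1_le R n_gt0)
  (@ratio_le R 63737 30240 3 isT isT) (@ratio_le R 101897 15120 7 isT isT)
  (@ratio_le R 22217 5040 5 isT isT) (@ratio_le R 1375 189 8 isT isT)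
  (@ratio_le R 187463 30240 7 isT isT) (@ratio_le R 35 16 3 isT isT)
  (@ratio_le R 449 27 17 isT isT) (@ratio_le R 130243 2520 52 isT isT)
  (@ratio_le R 7409 105 71 isT isT) (@ratio_le R 503803 15120 34 isT isT).
(* The leading term [g] of degree six cancels, leaving the expression bounded by [norm_error_le]. *)
have E (g a5 a4 a3 a2 a1 p : R) :
  g + a5 + a4 + a3 - a2 - a1 + p - g = a5 + a4 + a3 - a2 - a1 + p by ring.
by rewrite E.
Unshelve. all: by end_near.
Qed.
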